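(* Let $X$ be a connected $1$-complex with intrinsic distance $d_X$, let $X'=X/\partial X$ be the quotient complex, and let $\mathcal{C}$ be the girth of $X'$, i.e. the length of the shortest cycle in $X'$. Let $A=\{A_{\{1\}},\dots,A_{\{n\}}\}$ be a finite covering by closed $\varepsilon$-balls in $(X,d_X)$. Then: (i) if $\varepsilon<\frac14\mathcal{C}$, then $A$ is a good covering; (ii) if $\varepsilon<\frac16\mathcal{C}$, then the nerve $\mathcal{N}(A)$ equals the Vietoris--Rips complex $\mathcal{R}(A)$ of the nerve.
   Context: A connected $1$-complex $X$ is a connected space homeomorphic to a finite multigraph (loops and multiple edges allowed) whose edges have positive lengths; $d_X(x,y)$ is the length of a shortest path from $x$ to $y$. $\partial X$ is the set of leaf (degree one) vertices of $X$; $X/\partial X$ is obtained by identifying all points of $\partial X$ to one point ($X/\partial X=X$ if $\partial X=\emptyset$), with the same edge lengths; the girth is $+\infty$ if there is no cycle. A covering here is a finite family of subsets whose union need not be $X$; the balls are $A_{\{i\}}=\{x\in X: d_X(x,\xi_i)\le\varepsilon\}$ with centers $\xi_i\in X$. The covering is good if every nonempty intersection $A_{\{i_1\}}\cap\dots\cap A_{\{i_k\}}$ ($k\ge1$) is contractible. The nerve $\mathcal{N}(A)$ is the simplicial complex on vertices $1,\dots,n$ in which $I=\{i_1,\dots,i_{k+1}\}$ is a face iff $A_{\{i_1\}}\cap\dots\cap A_{\{i_{k+1}\}}\ne\emptyset$. For a simplicial complex $K$, the Vietoris--Rips complex $\mathcal{R}(K)$ is the maximal simplicial complex with the same $1$-skeleton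 as $K$ (every clique of the graph $K^{(1)}$ spans a face); $\mathcal{R}(A):=\mathcal{R}(\mathcal{N}(A))$. *)

(* Defs.v *)
From HB Require Import structures.
From mathcomp Require Import all_boot all_order all_algebra.
From mathcomp Require Import generic_quotient.
From mathcomp Require Import all_classical all_reals all_analysis.
Set Implicit Arguments.
Unset Strict Implicit.
Unset Printing Implicit Defensive.
Import Order.TTheory GRing.Theory Num.Theory.
Import numFieldNormedType.Exports.
Local Open Scope classical_set_scope.
Local Open Scope ring_scope.

(* Loops ([src e = tgt e]) and parallel edges are allowed; the orientation of
   an edge is only a parametrization. *)
Record multigraph (R : realType) := Multigraph {
  vertex : finType;
  edge : finType;
  src : edge -> vertex;
  tgt : edge -> vertex;
  len : edge -> R;
  len_gt0 : forall e, 0 < len e }.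

Section Boundary.
Variables (R : realType) (G : multigraph R).

(* A loop contributes 2 to the degree of its base vertex. *)
Definition degree (v : vertex G) : nat :=
  (#|[pred e | src e == v]| + #|[pred e | tgt e == v]|)%N.

Definition leaf (v : vertex G) : bool := degree v == 1%N.

Definition same_mod_boundary (u v : vertex G) : bool :=
  (u == v) || (leaf u && leaf v).

Lemma same_mod_boundary_equiv : equiv_class_of same_mod_boundary.
Proof.
split=> [u|u v|u v w]; rewrite /same_mod_boundary ?eqxx//.
  by rewrite eq_sym andbC.
by move=> /predU1P[->//|/andP[lv lu]] /predU1P[<-|/andP[_ lw]];
  rewrite ?lv ?lu ?lw orbT.
Qed.

Canonical same_mod_boundary_equiv_rel :=
  EquivRelPack same_mod_boundary_equiv.

Definition vertex_mod_boundary := {eq_quot same_mod_boundary}%qT.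

HB.instance Definition _ := [Finite of vertex_mod_boundary by <:%/].

Definition quotient_boundary : multigraph R :=
  @Multigraph R vertex_mod_boundary (edge G)
    (fun e => \pi_({eq_quot same_mod_boundary})%qT (src e))
    (fun e => \pi_({eq_quot same_mod_boundary})%qT (tgt e))
    (@len R G) (@len_gt0 R G).

End Boundary.

Section Girth.
Variables (R : realType) (G : multigraph R).

(* An oriented edge; [true] is the orientation from [src] to [tgt]. *)
Definition dart : Type := (edge G * bool)%type.
Definition dart_src (a : dart) := if a.2 then src a.1 else tgt a.1.
Definition dart_tgt (a : dart) := if a.2 then tgt a.1 else src a.1.

(* Simple closed walks: loops are cycles with one edge and pairs of parallel
   edges give cycles with two edges; distinctness of the edges excludes going
   back and forth along a single edge. *)
Definition simple_cycle (c : seq dart) : bool :=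
  [&& c != [::],
      path.cycle (fun a b : dart => dart_tgt a == dart_src b) c,
      uniq [seq a.1 | a <- c] & uniq [seq dart_src a | a <- c]].

Definition walk_length (c : seq dart) : R := \sum_(a <- c) len a.1.

(* There are finitely many simple cycles, so this infimum is a minimum, or
   [+oo] if there is no cycle. *)
Definition girth : \bar R :=
  ereal_inf [set (walk_length c)%:E | c in [set c | simple_cycle c]].

End Girth.

Section Realization.
Variables (R : realType) (G : multigraph R).

(* The underlying set of the geometric realization: the vertices and, for each
   edge [e], the interior points of [e], given by a coordinate in ]0, len e[. *)
Definition point_spec (p : vertex G + edge G * R) : bool :=
  if p is inr (e, t) then 0 < t < len e else true.

Record realization := Point {
  point_val :> (vertex G + edge G * R)%type;
  _ : point_spec point_val }.

HB.instance Definition _ := [isSub for point_val].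
HB.instance Definition _ := [Choice of realization by <:].

(* [at_coord e t x]: [x] is the image of [t] under the characteristic map
   [0, len e] -> X of the edge [e]. *)
Definition at_coord (e : edge G) (t : R) (x : realization) : bool :=
  match point_val x with
  | inl v => (t == 0) && (v == src e) || (t == len e) && (v == tgt e)
  | inr (e', t') => (e' == e) && (t' == t)
  end.

(* [pl_path x y l]: there is a piecewise linear path of length [l] from [x] to
   [y], i.e. a finite concatenation of segments each lying in a closed edge. *)
Inductive pl_path : realization -> realization -> R -> Prop :=
| pl_nil x : pl_path x x 0
| pl_cons x y z e s t l :
    at_coord e s x -> at_coord e t y -> pl_path y z l ->
    pl_path x z (`|s - t| + l).

(* Extended-real valued: [+oo] for points in different components. *)
Definition gdist (x y : realization) : \bar R :=
  ereal_inf [set l%:E | l in pl_path x y].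

Lemma pl_path_ge0 x y l : pl_path x y l -> 0 <= l.
Proof. by elim=> // *; rewrite addr_ge0. Qed.

Lemma pl_path_cat x y z l m :
  pl_path x y l -> pl_path y z m -> pl_path x z (l + m).
Proof.
elim=> [u|u v w e s t k us vt _ IH] wz; first by rewrite add0r.
by rewrite -addrA; apply: pl_cons us vt (IH wz).
Qed.

Lemma pl_path_sym x y l : pl_path x y l -> pl_path y x l.
Proof.
elim=> [u|u v w e s t k us vt _ IH]; first exact: pl_nil.
rewrite addrC -[X in _ + X]addr0 distrC.
exact: pl_path_cat IH (pl_cons vt us (pl_nil u)).
Qed.

Definition gball (x : realization) (r : R) : set realization :=
  [set y | (gdist x y < r%:E)%E].

Lemma gballP x r y : gball x r y <-> exists2 l, pl_path x y l & l < r.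
Proof.
split=> [/ereal_inf_lt[_ [l xy <-]]|[l xy lr]].
  by rewrite lte_fin => lr; exists l.
rewrite /gball/=; apply: (@le_lt_trans _ _ l%:E); last by rewrite lte_fin.
by apply: ereal_inf_lbound; exists l.
Qed.

Lemma gball_center x (r : R) : 0 < r -> gball x r x.
Proof. by move=> r0; apply/gballP; exists 0 => //; exact: pl_nil. Qed.

Lemma gball_sym x y (r : R) : gball x r y -> gball y r x.
Proof.
by move=> /gballP[l xy lr]; apply/gballP; exists l => //; exact: pl_path_sym.
Qed.

Lemma gball_triangle x y z (r s : R) :
  gball x r y -> gball y s z -> gball x (r + s) z.
Proof.
move=> /gballP[l xy lr] /gballP[m yz ms]; apply/gballP.
by exists (l + m); [exact: pl_path_cat yz|exact: ltrD].
Qed.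

HB.instance Definition _ :=
  hasNbhs.Build realization (nbhs_ (entourage_ gball)).
HB.instance Definition _ :=
  @Nbhs_isPseudoMetric.Build R realization (entourage_ gball) erefl
    gball gball_center gball_sym gball_triangle erefl.

Definition closed_gball (x : realization) (r : R) : set realization :=
  [set y | (gdist y x <= r%:E)%E].

End Realization.

(* The identity of the subspace [S] is homotopic, within [S], to a constant
   map; in particular [S] is nonempty. *)
Definition contractible (R : realType) (T : topologicalType) (S : set T) :
    Prop :=
  exists (x0 : T) (H : R * T -> T),
    [/\ S x0,
        {within `[0, 1] `*` S, continuous H},
        forall t x, `[0, 1]%classic t -> S x -> S (H (t, x)),
        forall x, S x -> H (0, x) = x &
        forall x, S x -> H (1, x) = x0].

Definition common_part (T : Type) (n : nat) (A : 'I_n -> set T)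
    (I : {set 'I_n}) : set T :=
  \bigcap_(i in [set` I]) A i.

(* The union of the family is not required to be all of [T]. *)
Definition good_covering (R : realType) (T : topologicalType) (n : nat)
    (A : 'I_n -> set T) : Prop :=
  forall I : {set 'I_n}, I != finset.set0 ->
    common_part A I !=set0 -> contractible R (common_part A I).

(* Abstract simplicial complexes with vertices among the elements of [V]; not
   every element of [V] needs to be a vertex. *)
Definition scomplex_axiom (V : finType) (F : {set {set V}}) : bool :=
  (finset.set0 \notin F) &&
  [forall I in F, forall J : {set V},
     (J != finset.set0) && (J \subset I) ==> (J \in F)].

Record scomplex (V : finType) := SComplex {
  faces :> {set {set V}};
  _ : scomplex_axiom faces }.

HB.instance Definition _ (V : finType) := [isSub for @faces V].

Section Complexes.
Variable V : finType.
Implicit Type K L : scomplex V.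

Lemma scomplexP (F : {set {set V}}) :
  reflect (finset.set0 \notin F /\
           forall I J : {set V}, I \in F -> J != finset.set0 ->
             J \subset I -> J \in F)
          (scomplex_axiom F).
Proof.
apply: (iffP andP) => -[F0 FS]; split=> //.
  move=> I J IF J0 JI; move/forall_inP: FS => /(_ _ IF)/forallP/(_ J).
  by rewrite J0 JI.
by apply/forall_inP => I IF; apply/forallP => J; apply/implyP => /andP[];
  exact: FS IF.
Qed.

Definition one_skeleton K : {set {set V}} := [set I in faces K | (#|I| <= 2)%N]%SET.

(* The cliques of the graph [K^(1)]; taking [i = j] below says that [i] is a
   vertex of [K]. *)
Definition rips_faces K : {set {set V}} :=
  [set I : {set V} | (I != finset.set0) &&
     [forall i in I, forall j in I, [set i; j]%SET \in one_skeleton K]]%SET.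

Lemma rips_subproof K : scomplex_axiom (rips_faces K).
Proof.
apply/scomplexP; split=> [|I J]; first by rewrite inE eqxx.
rewrite !inE => /andP[_ /forall_inP cI] -> /fintype.subsetP JI /=.
apply/forall_inP => i iJ; apply/forall_inP => j jJ.
by have /forall_inP := cI i (JI i iJ); apply; exact: JI.
Qed.

Definition rips K : scomplex V := SComplex (rips_subproof K).

Lemma pair_in_skeleton K (I : {set V}) i j :
  I \in faces K -> i \in I -> j \in I -> [set i; j]%SET \in one_skeleton K.
Proof.
have /scomplexP[_ KS] : scomplex_axiom (faces K) by case: K.
move=> IK iI jI; rewrite inE cards2; apply/andP; split; last by case: eqVneq.
apply: KS IK _ _; first by apply/set0Pn; exists i; rewrite !inE eqxx.
by apply/fintype.subsetP => k; rewrite !inE => /orP[]/eqP->.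
Qed.

Lemma faces_neq0 K (I : {set V}) : I \in faces K -> I != finset.set0.
Proof.
have /scomplexP[K0 _] : scomplex_axiom (faces K) by case: K.
by move=> IK; apply: contraNneq K0 => <-.
Qed.

(* [rips K] is the maximal complex with the same 1-skeleton as [K]. *)
Lemma one_skeleton_rips K : one_skeleton (rips K) = one_skeleton K.
Proof.
apply/setP => I; rewrite [LHS]inE [RHS]inE [I \in faces (rips K)]inE.
case: leqP => I2; rewrite ?andbF ?andbT//.
apply/andP/idP => [[I0 /forall_inP cI]|IK]; last first.
  split; first exact: faces_neq0 IK.
  apply/forall_inP => i iI; apply/forall_inP => j jI.
  exact: pair_in_skeleton IK iI jI.
have /set0Pn[i iI] := I0.
have pairK j : j \in I -> [set i; j]%SET \in faces K.
  move=> jI; have /forall_inP/(_ j jI) := cI i iI.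
  by rewrite inE => /andP[].
have [/eqP DI|/set0Pn[j]] := boolP ((I :\ i)%SET == finset.set0).
  suff -> : I = [set i; i]%SET by exact: pairK.
  by rewrite -(finset.setD1K iI) DI; apply/setP => k; rewrite !inE orbF orbb.
rewrite !inE => /andP[ji jI].
suff -> : I = [set i; j]%SET by exact: pairK.
apply/eqP; rewrite eq_sym eqEcard cards2 eq_sym ji I2 andbT.
by apply/fintype.subsetP => k; rewrite !inE => /orP[]/eqP->.
Qed.

Lemma rips_max K L :
  one_skeleton L = one_skeleton K -> faces L \subset faces (rips K).
Proof.
move=> LK; apply/fintype.subsetP => I IL; rewrite inE -LK (faces_neq0 IL) /=.
apply/forall_inP => i iI; apply/forall_inP => j jI.
by have := pair_in_skeleton IL iI jI; rewrite LK.
Qed.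

End Complexes.

Section Nerve.
Variables (T : Type) (n : nat) (A : 'I_n -> set T).

Definition nerve_faces : {set {set 'I_n}} :=
  [set I : {set 'I_n} | (I != finset.set0) &&
     `[< common_part A I !=set0 >]]%SET.

Lemma nerve_subproof : scomplex_axiom nerve_faces.
Proof.
apply/scomplexP; split=> [|I J]; first by rewrite inE eqxx.
rewrite !inE => /andP[_ /asboolP[x xI]] -> /fintype.subsetP JI /=.
by apply/asboolP; exists x => i /= /JI; exact: xI.
Qed.

Definition nerve : scomplex 'I_n := SComplex nerve_subproof.

End Nerve.

(* Main.v *)
Require Import Defs.
From mathcomp Require Import all_boot all_order all_algebra.
From mathcomp Require Import all_classical all_reals all_analysis.
From mathcomp Require Import generic_quotient.
From mathcomp Require Import ring lra zify.
Require Import Defs.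
Set Implicit Arguments.
Unset Strict Implicit.
Unset Printing Implicit Defensive.
Import Order.TTheory GRing.Theory Num.Theory.
Import numFieldNormedType.Exports.
Local Open Scope classical_set_scope.
Local Open Scope ring_scope.

(** Both parts follow from one fact: a closed path of [X] shorter than every
    cycle runs in a tree. No cycle passes through a leaf, so gluing the leaves
    together destroys no cycle, and the girth of the quotient bounds the cycles
    of [X] from below ([girth_reduced_cycles_ge]).

    The fact is used in the form of the four-point condition of tree metrics,
    local to small perimeters ([pl_path_four_point]): if paths of lengths
    [a, b, c, d] close up a quadrilateral [x, y, z, w] with [a + b + c + d] less
    than the length of every cycle, then the diagonals satisfy
      [d(x, z) + d(y, w) <= max (a + c) (b + d)].
    Suppose first that the corners are vertices. A closed walk along edges that
    is shorter than every cycle must backtrack somewhere. A backtrack inside a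
    side can be cut out; a backtrack at a corner lets that corner slide back by
    one edge, which shortens two adjacent sides, hence both terms of the
    maximum, by the length of the edge, and one diagonal by at most as much.
    Induction ends when a side is
    empty, where the inequality is trivial ([walk_four_point]). Corners in
    general position become vertices after subdividing the edges, which changes
    neither the lengths of paths nor those of cycles ([subdivide_at_points]).
    Subdividing also shows that distances are attained ([geodesic]), since the
    shortest walk between two vertices can be chosen among finitely many.

    The rest is metric geometry, with [4 * eps] or [6 * eps] bounding the
    perimeters. A ball contains the geodesics between its points
    ([closed_gball_convex]). If [p] is common to several balls, moving points
    towards [p] along geodesics, until their distance to [p] is at most
    [(1 - t) * (2 * eps)], is Lipschitz on small scales ([radial_lipschitz])
    and contracts the intersection of the balls onto [p]
    ([contractible_common_part]). If the balls only meet in pairs, choose two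
    centers at maximal distance: by the four-point condition no center is
    further than half that distance from the midpoint of these two, which
    therefore lies in all balls ([helly_closed_gball]). *)

(** * Walks along edges *)

Section Walks.
Context {R : realType} {G : multigraph R}.
Implicit Types (u v x y z w : vertex G) (a b : dart G) (s p q c : seq (dart G)).

Definition rev_dart a : dart G := (a.1, ~~ a.2).

Lemma dart_src_rev a : dart_src (rev_dart a) = dart_tgt a.
Proof. by case: a => e []. Qed.

Lemma dart_tgt_rev a : dart_tgt (rev_dart a) = dart_src a.
Proof. by case: a => e []. Qed.

Lemma rev_dart_neq a : rev_dart a != a.
Proof. by case: a => e [] /=; rewrite /rev_dart /eq_op /= eqxx. Qed.

Lemma same_edge a b : a.1 = b.1 -> b = a \/ b = rev_dart a.
Proof. by case: a b => [e b] [e' b'] /= <-; rewrite /rev_dart; case: b b' => [] [] /=; auto. Qed.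

Fixpoint walk u s v : bool :=
  if s is a :: s' then (dart_src a == u) && walk (dart_tgt a) s' v else u == v.

Definition follows a b : bool :=
  (dart_tgt a == dart_src b) && (b != rev_dart a).

Lemma walk_cat u s p v :
  walk u (s ++ p) v <-> exists2 w, walk u s w & walk w p v.
Proof.
elim: s u => [|a s IH] u /=.
  by split=> [h|[w /eqP <-]//]; exists u.
split=> [/andP[-> /IH[w h1 h2]]|[w /andP[-> h1] h2]]; first by exists w.
by apply/IH; exists w.
Qed.

Lemma walk_cat_trans u w v s p : walk u s w -> walk w p v -> walk u (s ++ p) v.
Proof. by move=> us wp; apply/walk_cat; exists w. Qed.

Lemma walk_length_cat s p : walk_length (s ++ p) = walk_length s + walk_length p.
Proof. by rewrite /walk_length big_cat. Qed.

Lemma walk_length_cons a s : walk_length (a :: s) = len a.1 + walk_length s.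
Proof. by rewrite /walk_length big_cons. Qed.

Lemma walk_length_nil : walk_length ([::] : seq (dart G)) = 0.
Proof. by rewrite /walk_length big_nil. Qed.

Lemma walk_length_ge0 s : 0 <= walk_length s.
Proof. by apply: sumr_ge0 => a _; apply/ltW/len_gt0. Qed.

Definition rev_walk s : seq (dart G) := rev [seq rev_dart a | a <- s].

Lemma walk_rev u s v : walk u s v -> walk v (rev_walk s) u.
Proof.
rewrite /rev_walk; elim: s u => [|a s IH] u /=; first by rewrite eq_sym.
move=> /andP[/eqP <- h]; rewrite rev_cons -cats1.
apply: walk_cat_trans (IH _ h) _ => /=.
by rewrite dart_src_rev dart_tgt_rev !eqxx.
Qed.

Lemma walk_length_rev s : walk_length (rev_walk s) = walk_length s.
Proof.
rewrite /walk_length /rev_walk (perm_big [seq rev_dart a | a <- s]) ?big_map//.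
by rewrite perm_rev.
Qed.

Lemma not_uniq_src s : ~~ uniq [seq dart_src a | a <- s] ->
  exists p a q b t, s = p ++ (a :: q) ++ b :: t /\ dart_src a = dart_src b.
Proof.
elim: s => [//|a s IH] /=; rewrite negb_and negbK => /orP[/mapP[b bs ab]|].
  by have [q t] := splitPr bs; exists [::], a, q, b, t.
by move=> /IH[p [a' [q [b [t [-> h]]]]]]; exists (a :: p), a', q, b, t.
Qed.

Lemma follows_walk a s : path follows a s ->
  walk (dart_tgt a) s (dart_tgt (last a s)).
Proof.
elim: s a => [|b s IH] a /=; first by rewrite eqxx.
by move=> /andP[/andP[/eqP -> _] /IH ->]; rewrite eqxx.
Qed.

(** An edge met twice at distinct vertices is met in opposite directions; the
    later traversal then starts where the earlier one ends, so it is either the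
    very next dart, a backtrack, or a second visit of that vertex. *)
Lemma reduced_uniq_edges s :
  sorted follows s -> uniq [seq dart_src a | a <- s] -> uniq [seq a.1 | a <- s].
Proof.
elim: s => [//|a s IH] /= fs /andP[aNs us].
rewrite IH ?(path_sorted fs) // andbT; apply/negP => /mapP[b bs /same_edge[ba|]].
  by move: aNs; rewrite -ba map_f.
move=> ba; case: s bs fs us {IH aNs} => [//|d s] bs /= /andP[/andP[/eqP ad da] _].
move=> /andP[dNs _]; move: bs; rewrite in_cons => /predU1P[bd|bs].
  by move: da; rewrite -bd ba eqxx.
by move: dNs; rewrite -ad -dart_src_rev -ba map_f.
Qed.

(** An innermost closed stretch of the walk visits no vertex twice. Only
    backtracking inside the walk is excluded, because the innermost stretch may
    backtrack where it closes up. *)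
Lemma reduced_closed_contains_simple_cycle a s :
  path follows a s -> dart_tgt (last a s) = dart_src a ->
  exists2 c : seq (dart G), simple_cycle c & walk_length c <= walk_length (a :: s).
Proof.
have [n] := ubnP (size s); elim: n a s => [//|n IH] a s sn fs cl.
have [us|] := boolP (uniq [seq dart_src b | b <- a :: s]).
  exists (a :: s) => //; rewrite /simple_cycle us (@reduced_uniq_edges (a :: s)) //=.
  rewrite !andbT rcons_path cl eqxx andbT.
  by apply: sub_path fs => x y /andP[].
move=> /not_uniq_src[p [b [q [d [t [E bd]]]]]].
have {}fs : sorted follows ((b :: q) ++ d :: t).
  by case: (@cat_sorted2 _ follows p ((b :: q) ++ d :: t)) => //; rewrite -E.
have [fbq /andP[/eqP bq _]] : path follows b q /\ follows (last b q) d.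
  by move: fs; rewrite /= cat_path => /andP[-> /andP[-> _]].
rewrite -bd in bq.
have [] := IH b q _ fbq bq.
  have := congr1 size E; rewrite /= size_cat /= size_cat /=; lia.
move=> c sc cl'; exists c => //; apply: le_trans cl' _.
rewrite E !walk_length_cat.
by have := walk_length_ge0 p; have := walk_length_ge0 (d :: t); lra.
Qed.

(** The form in which the girth is bounded below. Unlike simplicity, being
    cyclically reduced is a condition on consecutive darts, which is what the
    cancellation of backtracks and the subdivision of edges can control. *)
Definition reduced_cycles_ge (g : R) : Prop :=
  forall c, c != [::] -> path.cycle follows c -> g <= walk_length c.

Lemma simple_reduced_cycles_ge g :
  (forall c, simple_cycle c -> g <= walk_length c) -> reduced_cycles_ge g.
Proof.
move=> gs [//|a s] _ /=; rewrite rcons_path => /andP[fs /andP[/eqP cl _]].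
have [c sc cs] := reduced_closed_contains_simple_cycle fs cl.
exact: le_trans (gs _ sc) cs.
Qed.

Lemma cancel_backtrack u v a s :
  walk u (a :: s) v -> ~~ path follows a s ->
  exists p, [/\ walk u p v, (size p < size (a :: s))%N &
                walk_length p <= walk_length (a :: s)].
Proof.
elim: s u a => [//|b s IH] u a /= /and3P[/eqP <- /eqP ab wb].
have [ba|ba] := eqVneq b (rev_dart a).
  move=> _; exists s; split; [|by lia|].
    by move: wb; rewrite ba dart_tgt_rev.
  by rewrite !walk_length_cons; have := len_gt0 a.1; have := len_gt0 b.1; lra.
rewrite /follows ab eqxx ba /= => nf.
have [|p [wp sp lp]] := IH (dart_tgt a) b _ nf; first by rewrite /= ab eqxx.
exists (a :: p); split; first by rewrite /= eqxx.
  by move: sp => /=; lia.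
by rewrite walk_length_cons (walk_length_cons a); lra.
Qed.

Lemma corner_backtrack u v w a s b p :
  walk u (a :: s) v -> walk v (b :: p) w -> ~~ follows (last a s) b ->
  exists t q d, [/\ a :: s = rcons t d, b :: p = rev_dart d :: q,
     dart_tgt d = v, walk u t (dart_src d) & walk (dart_src d) q w].
Proof.
rewrite lastI -cats1 => /walk_cat[z wz /= /andP[/eqP lz /eqP lv]].
move=> /andP[/eqP bv wp] nf; have bl : b = rev_dart (last a s).
  by apply/eqP; move: nf; rewrite /follows lv bv eqxx negbK.
exists (belast a s), p, (last a s); split; rewrite ?lastI -?bl ?lz ?cats1//.
by move: wp; rewrite bl dart_tgt_rev lz.
Qed.

(** The four-point inequality for a quadrilateral with given sides; the lengths
    of [q] and [q'] stand for the distances between opposite corners. *)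
Definition four_point x y z w (p1 p2 p3 p4 : seq (dart G)) : Prop :=
  exists q q', [/\ walk x q z, walk y q' w & walk_length q + walk_length q' <=
    Num.max (walk_length p1 + walk_length p3) (walk_length p2 + walk_length p4)].

Lemma four_point_rot x y z w p1 p2 p3 p4 :
  four_point y z w x p2 p3 p4 p1 -> four_point x y z w p1 p2 p3 p4.
Proof.
move=> [q [q' [wq wq' h]]]; exists (rev_walk q'), q.
split=> //; first exact: walk_rev.
move: h; rewrite walk_length_rev maxC addrC.
by rewrite (addrC (walk_length p3)).
Qed.

Lemma four_point_mono x y z w p1 p2 p3 p4 p1' :
  walk_length p1' <= walk_length p1 ->
  four_point x y z w p1' p2 p3 p4 -> four_point x y z w p1 p2 p3 p4.
Proof.
move=> p11 [q [q' [wq wq' h]]]; exists q, q'; split=> //.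
by apply: le_trans h _; rewrite ge_max !le_max lerD2r p11 lexx orbT.
Qed.

(** When two adjacent corners coincide, the sides [p2] and [p4] serve as
    diagonals. *)
Lemma four_point_nil x y z w p2 p3 p4 :
  walk y p2 z -> walk w p4 x -> walk x [::] y -> four_point x y z w [::] p2 p3 p4.
Proof.
move=> wp2 wp4 /= /eqP xy; exists p2, (rev_walk p4).
rewrite xy; split=> //; first by rewrite -xy; exact: walk_rev.
by rewrite walk_length_rev le_max lexx orbT.
Qed.

(** The induction step at a corner: sliding the corner back by the dart [d]
    shortens both sides of the inequality by the length of [d]. *)
Lemma four_point_corner x z w p1 p2 p3 p4 d :
  four_point x (dart_src d) z w p1 p2 p3 p4 ->
  four_point x (dart_tgt d) z w (rcons p1 d) (rev_dart d :: p2) p3 p4.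
Proof.
move=> [q [q' [wq wq' h]]]; exists q, (rev_dart d :: q'); split=> //.
  by rewrite /= dart_src_rev dart_tgt_rev eqxx.
rewrite -cats1 walk_length_cat !walk_length_cons walk_length_nil /=.
move: h; rewrite !le_max => /orP[] h; apply/orP; [left|right]; lra.
Qed.

(** A nonempty closed walk shorter than all reduced cycles backtracks, either
    within a side or at a corner, and both kinds of backtrack can be removed. *)
Lemma walk_four_point g : reduced_cycles_ge g ->
  forall x y z w p1 p2 p3 p4,
  walk x p1 y -> walk y p2 z -> walk z p3 w -> walk w p4 x ->
  walk_length p1 + walk_length p2 + walk_length p3 + walk_length p4 < g ->
  four_point x y z w p1 p2 p3 p4.
Proof.
move=> ge_g x y z w p1 p2 p3 p4.
have [n] := ubnP (size p1 + size p2 + size p3 + size p4)%N.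
elim: n x y z w p1 p2 p3 p4 => [//|n IH].
have shorten x y z w a s p2 p3 p4 :
    ~~ path follows a s ->
    (size (a :: s) + size p2 + size p3 + size p4 < n.+1)%N ->
    walk x (a :: s) y -> walk y p2 z -> walk z p3 w -> walk w p4 x ->
    walk_length (a :: s) + walk_length p2 + walk_length p3 + walk_length p4 < g ->
    four_point x y z w (a :: s) p2 p3 p4.
  move=> nf sn w1 w2 w3 w4 lg; have [p [wp sp lp]] := cancel_backtrack w1 nf.
  apply: four_point_mono (lp) _; apply: IH => //; [|lra].
  by move: sp sn => /=; lia.
have retract x y z w a s b p2 p3 p4 :
    ~~ follows (last a s) b ->
    (size (a :: s) + size (b :: p2) + size p3 + size p4 < n.+1)%N ->
    walk x (a :: s) y -> walk y (b :: p2) z -> walk z p3 w -> walk w p4 x ->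
    walk_length (a :: s) + walk_length (b :: p2)
      + walk_length p3 + walk_length p4 < g ->
    four_point x y z w (a :: s) (b :: p2) p3 p4.
  move=> nf sn w1 w2 w3 w4 lg.
  have [t [q [d [E1 E2 dy wt wq]]]] := corner_backtrack w1 w2 nf.
  move: sn lg; rewrite E1 E2 -cats1 walk_length_cat !walk_length_cons.
  rewrite size_cat walk_length_nil cats1 /= => sn lg.
  rewrite -dy; apply: four_point_corner; apply: IH => //; first by lia.
  by have := len_gt0 d.1; lra.
move=> x y z w.
case=> [|a1 s1] p2 p3 p4.
  by move=> *; apply: four_point_nil.
case: p2 => [|a2 s2].
  by move=> *; apply: four_point_rot; apply: four_point_nil.
case: p3 => [|a3 s3].
  by move=> *; do 2 apply: four_point_rot; apply: four_point_nil.
case: p4 => [|a4 s4].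
  by move=> *; do 3 apply: four_point_rot; apply: four_point_nil.
move=> sn w1 w2 w3 w4 lg.
(* The same bounds for the quadrilateral started at its other corners. *)
have sn2 := sn; rewrite -!addnA addnC !addnA in sn2.
have sn3 := sn2; rewrite -!addnA addnC !addnA in sn3.
have sn4 := sn3; rewrite -!addnA addnC !addnA in sn4.
have lg2 := lg; rewrite -!addrA addrC !addrA in lg2.
have lg3 := lg2; rewrite -!addrA addrC !addrA in lg3.
have lg4 := lg3; rewrite -!addrA addrC !addrA in lg4.
have := @ge_g ((a1 :: s1) ++ (a2 :: s2) ++ (a3 :: s3) ++ (a4 :: s4)) isT.
rewrite !walk_length_cat !addrA.
rewrite (cycle_path a1) !last_cat !last_cons !cat_path !last_cons.
have [f41|/retract r _] := boolP (follows (last a4 s4) a1); last first.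
  by do 3 apply: four_point_rot; apply: r.
have [f1|/shorten r _] := boolP (path follows a1 s1); last exact: r.
have [f12|/retract r _] := boolP (follows (last a1 s1) a2); last exact: r.
have [f2|/shorten r _] := boolP (path follows a2 s2); last first.
  by apply: four_point_rot; apply: r.
have [f23|/retract r _] := boolP (follows (last a2 s2) a3); last first.
  by apply: four_point_rot; apply: r.
have [f3|/shorten r _] := boolP (path follows a3 s3); last first.
  by do 2 apply: four_point_rot; apply: r.
have [f34|/retract r _] := boolP (follows (last a3 s3) a4); last first.
  by do 2 apply: four_point_rot; apply: r.
have [f4|/shorten r _] := boolP (path follows a4 s4); last first.
  by do 3 apply: four_point_rot; apply: r.
by rewrite /= f41 f1 f12 f2 f23 f3 f34 f4 leNgt lg => /(_ isT).
Qed.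

(** Cutting out closed stretches leaves finitely many walks to consider when
    looking for a shortest one. *)
Lemma short_walk u s v : walk u s v ->
  exists p, [/\ walk u p v, (size p <= #|vertex G|)%N &
                walk_length p <= walk_length s].
Proof.
have [n] := ubnP (size s); elim: n s => [//|n IH] s sn ws.
have [us|] := boolP (uniq [seq dart_src a | a <- s]).
  exists s; split=> //; rewrite -(size_map (@dart_src _ _)).
  by rewrite -(card_uniqP us) max_card.
move=> /not_uniq_src[p [a [q [b [t [E ab]]]]]].
have [||r [wr sr lr]] := IH (p ++ b :: t); last first.
- exists r; split=> //; apply: le_trans lr _.
  by rewrite E !walk_length_cat; have := walk_length_ge0 (a :: q); lra.
- move: ws; rewrite E => /walk_cat[x wp /walk_cat[y /= /andP[/eqP xa _]]].
  by move=> /andP[_ wt]; apply: walk_cat_trans wp _; rewrite /= -ab xa eqxx.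
- by move: sn; rewrite E !size_cat /=; lia.
Qed.

Lemma shortest_walk u s v : walk u s v ->
  exists2 p, walk u p v & forall q, walk u q v -> walk_length p <= walk_length q.
Proof.
move=> /short_walk[s' [ws ss _]].
pose T := {bseq #|vertex G| of edge G * bool}.
pose s0 : T := Bseq ss.
have [/= p wp minp] := @arg_minP _ R T s0 (fun r => walk u (bseqval r) v)
  (fun r => @walk_length R G (bseqval r)) ws.
exists p => // q /short_walk[q' [wq sq lq]]; apply: le_trans lq.
exact: (minp (Bseq sq : T) wq).
Qed.

End Walks.

(** * Cycles and leaves *)

Lemma uniq_map_inj_in (T U : eqType) (f : T -> U) (s : seq T) :
  uniq [seq f x | x <- s] -> {in s &, injective f}.
Proof.
elim: s => [//|z s IH] /= /andP[zNs us] x y.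
rewrite !in_cons => /predU1P[->|xs] /predU1P[->|ys] // fxy; last exact: IH.
- by move: zNs; rewrite fxy map_f.
- by move: zNs; rewrite -fxy map_f.
Qed.

Section BoundaryGirth.
Context {R : realType} {G : multigraph R}.
Implicit Types (a b : dart G) (c : seq (dart G)) (v : vertex G).

Lemma two_darts_not_leaf a b v :
  a != b -> dart_src a = v -> dart_src b = v -> ~~ leaf v.
Proof.
have in2 (P : pred (edge G)) e e' : P e -> P e' -> e != e' -> (1 < #|P|)%N.
  by move=> Pe Pe' ee'; apply/card_gt1P; exists e, e'.
have in1 (P : pred (edge G)) e : P e -> (0 < #|P|)%N.
  by move=> Pe; apply/card_gt0P; exists e.
rewrite /leaf /degree; set S := #|_|; set T := #|_|.
have S2 e e' : src e == v -> src e' == v -> e != e' -> (1 < S)%N by apply: in2.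
have T2 e e' : tgt e == v -> tgt e' == v -> e != e' -> (1 < T)%N by apply: in2.
have S1 e : src e == v -> (0 < S)%N by apply: in1.
have T1 e : tgt e == v -> (0 < T)%N by apply: in1.
case: a b => [e i] [e' j]; rewrite /dart_src xpair_eqE.
case: i j => [] [] /=; rewrite ?andbT ?andbF => ee' /eqP ev /eqP e'v.
- by have := S2 _ _ ev e'v ee'; lia.
- by have := S1 _ ev; have := T1 _ e'v; lia.
- by have := T1 _ ev; have := S1 _ e'v; lia.
- by have := T2 _ _ ev e'v ee'; lia.
Qed.

(** A vertex of a cycle is the source of the dart that leaves it and of the
    reverse of the dart that enters it, hence is not a leaf. So the projection
    to the quotient is injective on the vertices of the cycle. *)
Lemma simple_cycle_quotient_boundary c :
  simple_cycle c -> @simple_cycle R (quotient_boundary G) c.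
Proof.
move=> /and4P[c0 cc ue us]; rewrite /simple_cycle c0 ue /=.
have nl a : a \in c -> ~~ leaf (dart_src a).
  move=> ac; have /eqP pa := prev_cycle cc ac.
  have pc : prev c a \in c by rewrite mem_prev.
  apply: (@two_darts_not_leaf (rev_dart (prev c a)) a) => //.
    apply: contraNneq (rev_dart_neq (prev c a)) => ra.
    by rewrite ra; apply/eqP/(uniq_map_inj_in ue ac pc); rewrite -[in LHS]ra.
  by rewrite dart_src_rev.
have -> : [seq @dart_src R (quotient_boundary G) a | a <- c] =
    [seq \pi_({eq_quot (@same_mod_boundary R G)})%qT v
       | v <- [seq dart_src a | a <- c]].
  by rewrite -map_comp; apply: eq_map => -[e []].
rewrite map_inj_in_uniq ?us ?andbT.
  apply: sub_cycle cc => -[e i] [e' j] /=; rewrite /dart_tgt /dart_src /=.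
  by case: i j => [] [] /= /eqP ->.
move=> _ _ /mapP[a ac ->] /mapP[b bc ->] /eqmodP /=.
by rewrite /same_mod_boundary (negbTE (nl a ac)) orbF => /eqP.
Qed.

(** A real bound [g] above [k * eps] replaces the girth, which may be [+oo]. *)
Lemma girth_reduced_cycles_ge (k eps : R) : 0 < k ->
  (eps%:E < (k^-1)%:E * girth (quotient_boundary G))%E ->
  exists2 g, k * eps < g & reduced_cycles_ge (G := G) g.
Proof.
move=> k0; set C := girth _; move=> epsC.
have Cc c : simple_cycle c -> (C <= (walk_length c)%:E)%E.
  by move=> /simple_cycle_quotient_boundary sc; apply: ereal_inf_lbound; exists c.
suff [g kg gC] : exists2 g, k * eps < g & forall r, (C <= r%:E)%E -> g <= r.
  by exists g => //; apply: simple_reduced_cycles_ge => c /Cc /gC.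
move: C epsC {Cc} => [r||] /=.
- rewrite -EFinM lte_fin => h; exists r => //.
  by rewrite -(ltr_pM2l k0) mulVKf ?gt_eqF in h.
- by move=> _; exists (k * eps + 1); [lra|].
- by rewrite gt0_muleNy ?lte_fin ?invr_gt0.
Qed.

End BoundaryGirth.

(** * Points of the realization *)

Section Points.
Context {R : realType} {G : multigraph R}.
Implicit Types (v : vertex G) (e : edge G) (t : R) (x : realization G).

Definition vertex_point v : realization G := @Point R G (inl v) isT.

Definition is_vertex x : Prop := exists v, x = vertex_point v.

(** The characteristic map of [e], extended by constants beyond the ends so
    that it needs no bounds on [t]. *)
Definition edge_point e t : realization G :=
  if t <= 0 then vertex_point (src e)
  else if len e <= t then vertex_point (tgt e)
  else insubd (vertex_point (src e)) (inr (e, t)).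

Lemma edge_point_src e t : t <= 0 -> edge_point e t = vertex_point (src e).
Proof. by rewrite /edge_point => ->. Qed.

Lemma edge_point_tgt e t : len e <= t -> edge_point e t = vertex_point (tgt e).
Proof.
move=> et; rewrite /edge_point et; case: (leP t 0) => // h.
by exfalso; have := len_gt0 e; lra.
Qed.

Lemma point_val_edge_point e t : 0 < t < len e ->
  point_val (edge_point e t) = inr (e, t).
Proof.
move=> /[dup] te /andP[t0 t1].
by rewrite /edge_point !leNgt t0 t1 /= -/(val _) val_insubd /= te.
Qed.

Lemma pointP x :
  (exists v, x = vertex_point v) \/
  (exists e t, 0 < t < len e /\ x = edge_point e t).
Proof.
case: x => -[v|[e t]] p; [left|right].
  by exists v; apply: val_inj.
by exists e, t; split=> //; apply: val_inj; rewrite /= point_val_edge_point.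
Qed.

Lemma at_coord_edge_point e t : 0 <= t <= len e -> at_coord e t (edge_point e t).
Proof.
move=> /andP[]; rewrite le_eqVlt => /predU1P[<- _|t0].
  by rewrite edge_point_src // /at_coord /= !eqxx.
rewrite le_eqVlt => /predU1P[->|t1].
  by rewrite edge_point_tgt // /at_coord /= !eqxx orbT.
by rewrite /at_coord point_val_edge_point ?t0 // !eqxx.
Qed.

Lemma at_coordP e t x : at_coord e t x -> 0 <= t <= len e /\ x = edge_point e t.
Proof.
have l0 := len_gt0 e.
have [[v ->]|[e' [t' [te' ->]]]] := pointP x; rewrite /at_coord.
  move=> /= /orP[] /andP[/eqP -> /eqP ->].
    by rewrite lexx ltW // edge_point_src.
  by rewrite lexx ltW // edge_point_tgt.
rewrite point_val_edge_point // => /andP[/eqP <- /eqP <-].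
by case/andP: te' => *; rewrite !ltW.
Qed.

End Points.

(** * Subdivision of the edges *)

Section Subdivision.
Context {R : realType} {G : multigraph R} (tau : edge G -> R).
Context (tauP : forall e, 0 < tau e < len e).
Implicit Types (v : vertex G) (e : edge G) (t : R).

(** The edge [e] is cut at [tau e] into [(e, false)], its half at the source,
    and [(e, true)], its half at the target. *)
Definition half_len (f : edge G * bool) : R :=
  if f.2 then len f.1 - tau f.1 else tau f.1.

Lemma half_len_gt0 f : 0 < half_len f.
Proof. by case: f => e []; have := tauP e; rewrite /half_len /=; lra. Qed.

Definition subdivision : multigraph R :=
  @Multigraph R (vertex G + edge G)%type (edge G * bool)%type
    (fun f => if f.2 then inr f.1 else inl (src f.1))
    (fun f => if f.2 then inl (tgt f.1) else inr f.1)
    half_len half_len_gt0.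

Implicit Types (x y : realization G).

Definition refine_edge_point e t : realization subdivision :=
  if t <= tau e then @edge_point R subdivision (e, false) t
  else @edge_point R subdivision (e, true) (t - tau e).

Definition refine_point x : realization subdivision :=
  match point_val x with
  | inl v => @vertex_point R subdivision (inl v)
  | inr (e, t) => refine_edge_point e t
  end.

Definition coarsen_point (p : realization subdivision) : realization G :=
  match point_val p with
  | inl (inl v) => vertex_point v
  | inl (inr e) => edge_point e (tau e)
  | inr ((e, b), t) => edge_point e (if b then t + tau e else t)
  end.

Lemma refine_edge_pointE e t :
  0 <= t <= len e -> refine_point (edge_point e t) = refine_edge_point e t.
Proof.
have te := tauP e; move=> /andP[]; rewrite le_eqVlt => /predU1P[<- _|t0].
  rewrite edge_point_src // /refine_edge_point ifT; last by lra.
  by rewrite edge_point_src.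
rewrite le_eqVlt => /predU1P[->|t1].
  rewrite edge_point_tgt // /refine_edge_point ifF; last by apply/negbTE; lra.
  by rewrite edge_point_tgt.
by rewrite /refine_point point_val_edge_point ?t0.
Qed.

Lemma at_coord_refine_lo e t x : at_coord e t x -> t <= tau e ->
  @at_coord R subdivision (e, false) t (refine_point x).
Proof.
move=> /at_coordP[te ->] tt; rewrite refine_edge_pointE // /refine_edge_point tt.
by apply: at_coord_edge_point; rewrite /= /half_len /= tt; case/andP: te => ->.
Qed.

Lemma at_coord_refine_hi e t x : at_coord e t x -> tau e <= t ->
  @at_coord R subdivision (e, true) (t - tau e) (refine_point x).
Proof.
move=> /at_coordP[te ->]; rewrite refine_edge_pointE // /refine_edge_point.
rewrite le_eqVlt => /predU1P[<-|tt].
  by rewrite lexx edge_point_tgt // subrr /at_coord /= !eqxx.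
rewrite leNgt tt /=.
by apply: at_coord_edge_point; rewrite /= /half_len /=; lra.
Qed.

Lemma at_coord_coarsen e b t p : @at_coord R subdivision (e, b) t p ->
  at_coord e (if b then t + tau e else t) (coarsen_point p).
Proof.
have te := tauP e; move=> /at_coordP[tb ->].
have := tb; rewrite /= => /andP[]; rewrite le_eqVlt => /predU1P[<- _|t0].
  rewrite edge_point_src //=; case: b tb => tb /=; last first.
    by rewrite /at_coord /= !eqxx.
  by rewrite add0r; apply: at_coord_edge_point; lra.
rewrite le_eqVlt => /predU1P[->|t1].
  rewrite edge_point_tgt //=; case: b tb => tb /=.
    by rewrite /half_len /= subrK /at_coord /= !eqxx orbT.
  by rewrite /half_len /=; apply: at_coord_edge_point; lra.
rewrite /coarsen_point point_val_edge_point /= ?t0 //.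
apply: at_coord_edge_point; move: t1 t0; rewrite /half_len /=.
by case: b {tb}; lra.
Qed.

Lemma refine_pointK : cancel refine_point coarsen_point.
Proof.
move=> x; have [[v -> //]|[e [t [/andP[t0 t1] ->]]]] := pointP x.
have te : 0 <= t <= len e by rewrite !ltW.
have /at_coordP[_ ->] : at_coord e t (coarsen_point (refine_point (edge_point e t))).
  have tx := at_coord_edge_point te.
  have [tt|/ltW tt] := leP t (tau e).
    exact: at_coord_coarsen (at_coord_refine_lo tx tt).
  by have := at_coord_coarsen (at_coord_refine_hi tx tt); rewrite /= subrK.
by [].
Qed.

(** A segment across the cut point is broken there into two segments. *)
Lemma pl_path_refine x y l : pl_path x y l ->
  pl_path (refine_point x) (refine_point y) l.
Proof.
elim=> [u|u v w e s t k us vt _ IH]; first exact: pl_nil.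
pose m : realization subdivision := @vertex_point R subdivision (inr e).
have m_lo : at_coord ((e, false) : edge subdivision) (tau e) m.
  by rewrite /at_coord /= !eqxx orbT.
have m_hi : at_coord ((e, true) : edge subdivision) 0 m.
  by rewrite /at_coord /= !eqxx.
have [se|/ltW se] := leP s (tau e); have [te|/ltW te] := leP t (tau e).
- exact: pl_cons (at_coord_refine_lo us se) (at_coord_refine_lo vt te) IH.
- have := pl_cons (at_coord_refine_lo us se) m_lo
    (pl_cons m_hi (at_coord_refine_hi vt te) IH).
  congr pl_path; rewrite addrA; congr (_ + _).
  by rewrite !ler0_norm; lra.
- have := pl_cons (at_coord_refine_hi us se) m_hi
    (pl_cons m_lo (at_coord_refine_lo vt te) IH).
  congr pl_path; rewrite addrA; congr (_ + _).
  by rewrite !ger0_norm; lra.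
- have := pl_cons (at_coord_refine_hi us se) (at_coord_refine_hi vt te) IH.
  by congr pl_path; congr (_ + _); congr (`|_|); lra.
Qed.

Lemma pl_path_coarsen p q l : pl_path p q l ->
  pl_path (coarsen_point p) (coarsen_point q) l.
Proof.
elim=> [u|u v w [e b] s t k us vt _ IH]; first exact: pl_nil.
have := pl_cons (at_coord_coarsen us) (at_coord_coarsen vt) IH.
by congr pl_path; congr (_ + _); case: b us vt => // *; congr (`|_|); lra.
Qed.

Lemma pl_path_refineE x y l :
  pl_path x y l <-> pl_path (refine_point x) (refine_point y) l.
Proof.
split; first exact: pl_path_refine.
by move=> /pl_path_coarsen; rewrite !refine_pointK.
Qed.

End Subdivision.

Section SubdivisionCycles.
Context {R : realType} {G : multigraph R} (tau : edge G -> R).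
Context (tauP : forall e, 0 < tau e < len e).
Local Notation S := (subdivision tauP).
Implicit Types (v : vertex G) (e : edge G) (A B : dart G) (C : seq (dart G)).
Implicit Types (a b : dart S) (s c : seq (dart S)).

(** The two halves of a dart in the order in which it traverses them. *)
Definition first_half A : dart S := ((A.1, ~~ A.2), A.2).
Definition second_half A : dart S := ((A.1, A.2), A.2).
Definition refine_walk C : seq (dart S) :=
  flatten [seq [:: first_half A; second_half A] | A <- C].

Lemma walk_length_refine C : walk_length (refine_walk C) = walk_length C.
Proof.
elim: C => [|[e i] C IH]; first by rewrite !walk_length_nil.
rewrite /refine_walk /= -/(refine_walk C) !walk_length_cons IH /= /half_len.
by case: i => /=; lra.
Qed.

(** A reduced walk that enters an edge from an end cannot turn back at its cut
    point, so it traverses the whole edge. *)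
Lemma reduced_walk_refine v w s : sorted follows s ->
  walk (inl v : vertex S) s (inl w) -> exists C, s = refine_walk C.
Proof.
have [n] := ubnP (size s); elim: n s v => [//|n IH] [|a [|b s]] v.
- by move=> *; exists [::].
- by move=> _ _ /= /andP[/eqP + /eqP]; case: a => [[e []] []].
have next A : a = first_half A -> (size (a :: b :: s) < n.+1)%N ->
    sorted follows (a :: b :: s) -> walk (inl v : vertex S) (a :: b :: s) (inl w) ->
    exists C, a :: b :: s = refine_walk C.
  move=> -> sn /= /andP[/andP[ab ba] fs] /andP[_ /andP[_ ws]].
  have E : b = second_half A.
    case: A b {sn fs ws} ab ba => [e i] [[f j] k].
    rewrite /second_half /first_half /rev_dart /= /dart_tgt /dart_src /=.
    by case: i j k => [] [] [] //= /eqP [->]; rewrite ?eqxx.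
  have [|||C ->] := IH s (dart_tgt A).
  - by move: sn => /=; lia.
  - exact: path_sorted fs.
  - by move: ws; rewrite E; case: (A) => e [].
  by exists (A :: C); rewrite E.
move=> sn fs ws; case: a next fs ws sn => [[e i] j] next fs ws sn.
case: i j next fs ws sn => [] [] next fs ws sn.
- by move: ws.
- by apply: next (e, false) _ _ _ _.
- by apply: next (e, true) _ _ _ _.
- by move: ws.
Qed.

Lemma follows_refine A B :
  follows (second_half A) (first_half B) -> follows A B.
Proof.
case: A B => [e i] [f j]; rewrite /follows /rev_dart /dart_tgt /dart_src.
rewrite /second_half /first_half /=.
case: i j => [] [] /= /andP[/eqP [->]]; rewrite !xpair_eqE /= ?eqxx ?andbT ?andbF //.
Qed.

Lemma path_refine_walk A C :
  path follows (second_half A) (refine_walk C) -> path follows A C.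
Proof.
elim: C A => [//|B C IH] A /=.
by rewrite -/(refine_walk C) => /and3P[/follows_refine -> _ /IH].
Qed.

(** A reduced cycle of the subdivision, started at a vertex of [G], refines a
    reduced cycle of [G] of the same length. *)
Lemma reduced_cycles_ge_subdivision g :
  reduced_cycles_ge (G := G) g -> reduced_cycles_ge (G := S) g.
Proof.
move=> Gg c c0 fc.
wlog [v [a [s [E av]]]] : c c0 fc /
    exists v a s, c = a :: s /\ dart_src a = inl v.
  move=> base; case: c c0 fc => [//|a s] _ fc.
  have [[v av]|[e ae]] : (exists v, dart_src a = inl v) \/
      (exists e, dart_src a = inr e).
  - by case: (dart_src a) => [v|e]; [left; exists v|right; exists e].
  - by apply: base fc _ => //; exists v, a, s.
  (* Starting one dart later, the cycle starts at an end of the edge [e]. *)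
  have -> : walk_length (a :: s) = walk_length (rot 1 (a :: s)).
    by apply: perm_big; rewrite perm_sym perm_rot.
  apply: base; rewrite ?rot_cycle //; first by case: (s).
  case: s fc => [|b s] /=.
    by case: a ae => [[f []] []].
  move=> /andP[/andP[/eqP ab _] _].
  have [v bv] : exists v, dart_src b = inl v.
    by rewrite -ab; case: a ae {ab} => [[f []] []] //= _; eexists.
  by exists v, b, (rcons s a); rewrite rot1_cons.
have ws : walk (inl v : vertex S) c (inl v).
  move: fc; rewrite E /= rcons_path => /andP[/follows_walk ws /andP[/eqP lv _]].
  by rewrite av eqxx -av -lv.
have [|C EC] := reduced_walk_refine _ ws.
  by move: fc; rewrite E /= rcons_path => /andP[].
rewrite EC walk_length_refine; apply: Gg.
  by apply: contraNneq c0 => C0; rewrite EC C0.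
move: fc; rewrite EC; case: C {EC} => [//|A C].
rewrite (cycle_path (first_half A)) (cycle_path A) => fc.
apply: path_refine_walk; move: fc; congr path.
elim/last_ind: (C) => [//|C' B _] /=.
by rewrite /refine_walk map_rcons flatten_rcons last_cat last_rcons.
Qed.

End SubdivisionCycles.

(** Edges not containing [x] are cut in the middle. *)
Lemma subdivide_at (R : realType) (G : multigraph R) (x : realization G) :
  exists (S : multigraph R) (f : realization G -> realization S),
  [/\ is_vertex (f x), forall y, is_vertex y -> is_vertex (f y),
      forall y z l, pl_path y z l <-> pl_path (f y) (f z) l &
      forall g, reduced_cycles_ge (G := G) g -> reduced_cycles_ge (G := S) g].
Proof.
have [xv|[e [t [te ->]]]] := pointP x; first by exists G, id; split.
pose tau f := if f == e then t else len f / 2.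
have tauP f : 0 < tau f < len f.
  by rewrite /tau; case: eqP => [->//|_]; have := len_gt0 f; lra.
exists (subdivision tauP), (refine_point tauP); split.
- exists (inr e); rewrite refine_edge_pointE; last by lra.
  rewrite /refine_edge_point /tau eqxx lexx.
  by rewrite edge_point_tgt //= /half_len /tau /= eqxx.
- by move=> _ [v ->]; exists (inl v).
- by move=> y z l; exact: pl_path_refineE.
- by move=> g; exact: reduced_cycles_ge_subdivision.
Qed.

(** Finitely many points may be assumed to be vertices, by subdividing once for
    each of them. *)
Lemma subdivide_at_points (R : realType) (G : multigraph R)
    (xs : seq (realization G)) :
  exists (S : multigraph R) (f : realization G -> realization S),
  [/\ forall x, x \in xs -> is_vertex (f x),
      forall y z l, pl_path y z l <-> pl_path (f y) (f z) l &
      forall g, reduced_cycles_ge (G := G) g -> reduced_cycles_ge (G := S) g].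
Proof.
(* The induction needs to know that vertices remain vertices. *)
suff [S [f [xf _ pf gf]]] : exists (S : multigraph R)
    (f : realization G -> realization S),
  [/\ forall x, x \in xs -> is_vertex (f x),
      forall y, is_vertex y -> is_vertex (f y),
      forall y z l, pl_path y z l <-> pl_path (f y) (f z) l &
      forall g, reduced_cycles_ge (G := G) g -> reduced_cycles_ge (G := S) g].
  by exists S, f.
elim: xs => [|x xs [S [f [fxs fv fp fg]]]]; first by exists G, id; split.
have [S2 [f2 [fx2 fv2 fp2 fg2]]] := subdivide_at (f x).
exists S2, (f2 \o f); split=> /=.
- by move=> y; rewrite in_cons => /predU1P[->//|/fxs /fv2].
- by move=> y /fv /fv2.
- by move=> y z l; rewrite fp fp2.
- by move=> g /fg /fg2.
Qed.

(** * Geodesics and the four-point condition *)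

Section PathsAndWalks.
Context {R : realType} {G : multigraph R}.
Implicit Types (u v : vertex G) (e : edge G) (t l : R) (x y z : realization G).
Implicit Types (s : seq (dart G)).

Lemma walk_pl_path u s v : walk u s v ->
  pl_path (vertex_point u) (vertex_point v) (walk_length s).
Proof.
elim: s u => [|a s IH] u /=.
  by move=> /eqP ->; rewrite walk_length_nil; exact: pl_nil.
move=> /andP[/eqP <- /IH ps]; rewrite walk_length_cons.
have at0 e : at_coord e 0 (vertex_point (src e)) by rewrite /at_coord /= !eqxx.
have at1 e : at_coord e (len e) (vertex_point (tgt e)).
  by rewrite /at_coord /= !eqxx orbT.
case: a ps => e [] ps.
  by have := pl_cons (at0 e) (at1 e) ps; rewrite sub0r normrN gtr0_norm ?len_gt0.
by have := pl_cons (at1 e) (at0 e) ps; rewrite subr0 gtr0_norm ?len_gt0.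
Qed.

(** The point with coordinate [t] on [e] reaches [v] within length [l] by first
    leaving [e] through one of its ends. *)
Definition exits e t v l : Prop :=
  (exists2 s, walk (src e) s v & t + walk_length s <= l) \/
  (exists2 s, walk (tgt e) s v & len e - t + walk_length s <= l).

Definition walks_to x v l : Prop :=
  match point_val x with
  | inl u => exists2 s, walk u s v & walk_length s <= l
  | inr (e, t) => exits e t v l
  end.

Lemma walks_to_exits e t x v l : at_coord e t x -> walks_to x v l <-> exits e t v l.
Proof.
have l0 := len_gt0 e; rewrite /at_coord /walks_to.
case: (point_val x) => [u|[f r] /andP[/eqP -> /eqP ->] //].
move=> /orP[] /andP[/eqP -> /eqP ->].
- split=> [[s ws sl]|[] [s ws sl]]; first by left; exists s; rewrite ?add0r.
    by exists s => //; rewrite add0r in sl.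
  exists ((e, true) :: s); first by rewrite /= eqxx.
  by rewrite walk_length_cons /=; lra.
- split=> [[s ws sl]|[] [s ws sl]]; first by right; exists s; rewrite ?subrr ?add0r.
    exists ((e, false) :: s); first by rewrite /= eqxx.
    by rewrite walk_length_cons /=; lra.
  by exists s => //; rewrite subrr add0r in sl.
Qed.

(** Straightening a path: by induction on its segments, from any of its points
    the end can be reached by leaving the current edge through an end and then
    walking along full edges, without increase of length. *)
Lemma pl_path_walk u v l : pl_path (vertex_point u) (vertex_point v) l ->
  exists2 s, walk u s v & walk_length s <= l.
Proof.
suff H x y : pl_path x y l -> forall v, y = vertex_point v -> walks_to x v l.
  by move=> /H /(_ v erefl).
elim=> {x y l} [_ w ->|x y z e s t l xs yt _ IH w zw].
  by exists [::]; rewrite /= ?eqxx ?walk_length_nil.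
have /(walks_to_exits w l yt) h := IH w zw.
apply/(walks_to_exits w _ xs).
have n1 := ler_norm (s - t).
have n2 : t - s <= `|s - t| by rewrite ler_normr opprB lexx orbT.
by case: h => -[p wp pl]; [left|right]; exists p => //; lra.
Qed.

Lemma pl_path_interpolate x y l t : pl_path x y l -> 0 <= t <= l ->
  exists2 z, pl_path x z t & pl_path z y (l - t).
Proof.
move=> xy; elim: xy t => {x y l} [x|x y z e s r l xs yr yz IH] t.
  move=> /andP[t0 t1]; exists x; first by rewrite (_ : t = 0) ?subrr; [exact: pl_nil|lra].
  by rewrite (_ : 0 - t = 0); [exact: pl_nil|lra].
move=> /andP[t0 t1]; have [tn|nt] := leP t `|s - r|; last first.
  have [|w yw wz] := IH (t - `|s - r|); first by lra.
  exists w; last by move: wz; congr pl_path; lra.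
  by move: (pl_cons xs yr yw); congr pl_path; lra.
have [/andP[s0 s1] _] := at_coordP xs; have [/andP[r0 r1] _] := at_coordP yr.
pose q := if s <= r then s + t else s - t.
have [q01 sq qr] : [/\ 0 <= q <= len e, `|s - q| = t & `|q - r| = `|s - r| - t].
  rewrite /q; case: (leP s r) tn => sr.
    rewrite (ler0_norm (_ : s - r <= 0)) => [tn|]; last by lra.
    by split; [lra|rewrite ler0_norm; lra|rewrite ler0_norm; lra].
  rewrite (ger0_norm (_ : 0 <= s - r)) => [tn|]; last by lra.
  by split; [lra|rewrite ger0_norm; lra|rewrite ger0_norm; lra].
have qe := at_coord_edge_point q01.
exists (edge_point e q).
  by move: (pl_cons xs qe (pl_nil _)); congr pl_path; lra.
by move: (pl_cons qe yr yz); congr pl_path; lra.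
Qed.

End PathsAndWalks.

Section Geodesics.
Context {R : realType} {G : multigraph R}.
Implicit Types (l : R) (x y z : realization G).

(** Distances are attained: once [x] and [y] are vertices, only walks matter. *)
Lemma geodesic x y l : pl_path x y l ->
  exists2 m, pl_path x y m & forall k, pl_path x y k -> m <= k.
Proof.
have [S [f [fv fp _]]] := subdivide_at_points [:: x; y].
have [|u xu] := fv x; first by rewrite mem_head.
have [|v yv] := fv y; first by rewrite in_cons mem_head orbT.
move=> /fp; rewrite xu yv => /pl_path_walk[s ws _].
have [p wp minp] := shortest_walk ws.
exists (walk_length p); first by apply/fp; rewrite xu yv; exact: walk_pl_path.
move=> k /fp; rewrite xu yv => /pl_path_walk[q wq]; apply: le_trans.
exact: minp.
Qed.

(** As distances are attained, the infimum in the definition of a closed ball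
    can be replaced by a path. *)
Lemma closed_gballP x r y :
  closed_gball x r y <-> exists2 l, pl_path y x l & l <= r.
Proof.
split=> [yr|[l yx lr]]; last first.
  by apply: le_trans (_ : (l%:E <= r%:E)%E); [apply: ereal_inf_lbound; exists l|].
have /ereal_inf_lt[_ [l0 yx <-] _] : (gdist y x < (r + 1)%:E)%E.
  by apply: le_lt_trans yr _; rewrite lte_fin; lra.
have [l yl minl] := geodesic yx; exists l => //.
rewrite -lee_fin; apply: le_trans yr; apply: le_ereal_inf_tmp => _ [k yk <-].
by rewrite lee_fin minl.
Qed.

(** Once the corners are vertices, the sides can be replaced by walks that are
    no longer, and the walks obtained on the diagonals are paths. *)
Lemma pl_path_four_point g x y z w a b c d : reduced_cycles_ge (G := G) g ->
  pl_path x y a -> pl_path y z b -> pl_path z w c -> pl_path w x d ->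
  a + b + c + d < g ->
  exists l m, [/\ pl_path x z l, pl_path y w m & l + m <= Num.max (a + c) (b + d)].
Proof.
have [S [f [fv fp fg]]] := subdivide_at_points [:: x; y; z; w].
have [|vx xE] := fv x; first by rewrite !in_cons eqxx ?orbT.
have [|vy yE] := fv y; first by rewrite !in_cons eqxx ?orbT.
have [|vz zE] := fv z; first by rewrite !in_cons eqxx ?orbT.
have [|vw wE] := fv w; first by rewrite !in_cons eqxx ?orbT.
move=> /fg gS /fp + /fp + /fp + /fp; rewrite xE yE zE wE.
move=> /pl_path_walk[p1 w1 l1] /pl_path_walk[p2 w2 l2].
move=> /pl_path_walk[p3 w3 l3] /pl_path_walk[p4 w4 l4] abcd.
have [|q [q' [wq wq' h]]] := walk_four_point gS w1 w2 w3 w4; first by lra.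
exists (walk_length q), (walk_length q'); split.
- by apply/fp; rewrite xE zE; exact: walk_pl_path.
- by apply/fp; rewrite yE wE; exact: walk_pl_path.
- by move: h; rewrite !le_max => /orP[] h; apply/orP; [left|right]; lra.
Qed.

End Geodesics.

(** * Convexity, contraction and the Helly property *)

Section TreeLikeBalls.
Context {R : realType} {G : multigraph R} {g : R}.
Context (Gg : reduced_cycles_ge (G := G) g).
Implicit Types (c p q x y z : realization G) (l s t d eps : R).

Definition is_dist x y d : Prop :=
  pl_path x y d /\ forall l, pl_path x y l -> d <= l.

Lemma pl_path0 x y : pl_path x y 0 -> x = y.
Proof.
suff H l : pl_path x y l -> l = 0 -> x = y by move=> /H; apply.
elim=> {x y l} // x y z e s t l xs yt yz IH st0.
have l0 := pl_path_ge0 yz; have n0 := normr_ge0 (s - t).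
have st : s = t by apply/eqP; rewrite -subr_eq0 -normr_eq0; apply/eqP; lra.
rewrite -IH; last by lra.
by have [_ ->] := at_coordP xs; have [_ ->] := at_coordP yt; rewrite st.
Qed.

(** The four-point inequality for [c, p, z, q]: the diagonal from [p] to [q] has
    length at least [d = s + (d - s)], which leaves at most [eps] for the
    diagonal from [c] to [z]. *)
Lemma closed_gball_convex eps c p q d s z : 4 * eps < g ->
  closed_gball c eps p -> closed_gball c eps q -> is_dist p q d ->
  pl_path p z s -> pl_path z q (d - s) -> closed_gball c eps z.
Proof.
move=> epsg /closed_gballP[a pc ae] /closed_gballP[b qc be] [pq mind] pz zq.
have dab := mind _ (pl_path_cat pc (pl_path_sym qc)).
have [|l [m [cz pq' lm]]] := pl_path_four_point Gg (pl_path_sym pc) pz zq qc.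
  by lra.
apply/closed_gballP; exists l; first exact: pl_path_sym.
by have := mind _ pq'; move: lm; rewrite le_max => /orP[];
  have := pl_path_ge0 pz; have := pl_path_ge0 zq; lra.
Qed.

(** The map that moves [q] along a geodesic towards [p], to distance at most
    [s] from [p], is Lipschitz in [s] and [q]. The inequality is the four-point
    condition for [p, z, q, z'], where the path from [q] to [z'] runs
    through [q']. *)
Lemma radial_lipschitz p q q' d d' s s' z z' t :
  is_dist p q d -> is_dist p q' d' -> pl_path q q' t -> d + d' + t < g ->
  pl_path p z (Num.min s d) -> pl_path z q (d - Num.min s d) ->
  pl_path p z' (Num.min s' d') -> pl_path z' q' (d' - Num.min s' d') ->
  exists2 m, pl_path z z' m & m <= `|s - s'| + 3 * t.
Proof.
move=> [pq mind] [pq' mind'] qq' perim pz zq pz' zq'.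
have dt := mind _ (pl_path_cat pq' (pl_path_sym qq')).
have dt' := mind' _ (pl_path_cat pq qq').
have [|l [m [pql zz' lm]]] := pl_path_four_point Gg pz zq
  (pl_path_cat qq' (pl_path_sym zq')) (pl_path_sym pz'); first by lra.
exists m => //; have := mind _ pql; have t0 := pl_path_ge0 qq'.
have ss : s - s' <= `|s - s'| by exact: ler_norm.
have ss' : s' - s <= `|s - s'| by rewrite distrC; exact: ler_norm.
move: lm; rewrite le_max minEle minEle.
by case: (leP s d) => sd; case: (leP s' d') => sd' /orP[]; lra.
Qed.

(** With [c i], [c j] two centers at maximal distance [d] and [m] their midpoint,
    the four-point inequality for [c i, m, c j, c k] gives
    [d + d(m, c k) <= d / 2 + d], and [d <= 2 * eps]. *)
Lemma helly_closed_gball (I : finType) (P : {set I}) (c : I -> realization G) eps :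
  6 * eps < g -> P != finset.set0 ->
  (forall i j, i \in P -> j \in P ->
    closed_gball (c i) eps `&` closed_gball (c j) eps !=set0) ->
  exists z, forall i, i \in P -> closed_gball (c i) eps z.
Proof.
move=> epsg /set0Pn[i0 i0P] meet.
have distE (ij : I * I) : exists d, ij.1 \in P -> ij.2 \in P ->
    is_dist (c ij.1) (c ij.2) d /\ d <= 2 * eps.
  have [/andP[iP jP]|nP] := boolP ((ij.1 \in P) && (ij.2 \in P)); last first.
    by exists 0 => iP jP; rewrite iP jP in nP.
  have [z [/closed_gballP[a za ae] /closed_gballP[b zb be]]] := meet _ _ iP jP.
  have ij2 := pl_path_cat (pl_path_sym za) zb.
  have [d pd mind] := geodesic ij2; exists d => _ _; split=> //.
  by have := mind _ ij2; lra.
have [D DP] := choice distE.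
have [[i j] /= /andP[iP jP] maxD] := @arg_maxP _ R (I * I)%type (i0, i0)
  (fun ij => (ij.1 \in P) && (ij.2 \in P)) D (introT andP (conj i0P i0P)).
have [[pij minij] ij2] := DP (i, j) iP jP; rewrite /= in pij minij.
have D0 := pl_path_ge0 pij.
have [|m im mj] := pl_path_interpolate (t := D (i, j) / 2) pij; first by lra.
exists m => k kP; apply/closed_gballP.
have [[pjk _] jk2] := DP (j, k) jP kP; have [[pki _] ki2] := DP (k, i) kP iP.
have /= maxjk := maxD (j, k) (introT andP (conj jP kP)).
have /= maxki := maxD (k, i) (introT andP (conj kP iP)).
have [|l [n [ijl mk ln]]] := pl_path_four_point Gg im mj pjk pki; first by lra.
exists n => //; have := minij _ ijl.
by move: ln; rewrite le_max => /orP[]; lra.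
Qed.

(** Any common point [p] is a center of contraction: at time [t] each point has
    moved along a geodesic towards [p] until its distance to [p] is at most
    [(1 - t) * (2 * eps)], and [2 * eps] bounds the initial distances. *)
Lemma contractible_common_part n (xi : 'I_n -> realization G) (eps : R)
    (I : {set 'I_n}) :
  let S := common_part (fun i => closed_gball (xi i) eps) I in
  4 * eps < g -> I != finset.set0 -> S !=set0 -> contractible R S.
Proof.
move=> S epsg /set0Pn[i0 i0I] [p Sp].
have S2 q : S q -> exists2 l, pl_path p q l & l <= 2 * eps.
  move=> Sq; have /closed_gballP[a pa ae] := Sp _ i0I.
  have /closed_gballP[b qb be] := Sq _ i0I.
  by exists (a + b); [exact: pl_path_cat pa (pl_path_sym qb)|lra].
have eps0 : 0 <= eps.
  have /closed_gballP[a pa ae] := Sp _ i0I.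
  exact: le_trans (pl_path_ge0 pa) ae.
have distE q : exists d, S q -> is_dist p q d /\ d <= 2 * eps.
  have [Sq|nSq] := pselect (S q); last by exists 0.
  have [l pq le] := S2 _ Sq; have [d pd mind] := geodesic pq.
  by exists d => _; split=> //; apply: le_trans (mind _ pq) le.
have [D DP] := choice distE.
pose radius (t : R) := (1 - t) * (2 * eps).
have moveE (tq : R * realization G) : exists z,
    `[0, 1]%classic tq.1 -> S tq.2 ->
    let r := Num.min (radius tq.1) (D tq.2) in
    pl_path p z r /\ pl_path z tq.2 (D tq.2 - r).
  case: tq => t q /=; have [[Sq t01]|nSq] := pselect (S q /\ `[0, 1]%classic t); last first.
    by exists p => t01 Sq; exfalso; apply: nSq.
  have [[pd _] _] := DP q Sq; have d0 := pl_path_ge0 pd.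
  have [|z pz zq] := pl_path_interpolate (t := Num.min (radius t) (D q)) pd.
    rewrite le_min ge_min d0 lexx orbT !andbT; apply: mulr_ge0; last by lra.
    by move: t01; rewrite /= in_itv /= => /andP[]; lra.
  by exists z.
have [H HP] := choice moveE.
exists p, H; split=> //.
- apply/subspace_continuousP => -[t q] [/= t01 Sq] U /nbhs_ballP[e /= e0 eU].
  (* The first bound keeps perimeters below [g]; the second one is the quotient
     of [e] by the Lipschitz constant. *)
  pose rho := Num.min (g - 4 * eps) (e / (2 * eps + 3)).
  have rho0 : 0 < rho.
    by rewrite lt_min; apply/andP; split; [lra|apply: divr_gt0; lra].
  rewrite /within /= nbhs_simpl /=.
  apply/nbhs_ballP; exists rho => //= -[t' q'] [/= tt' qq'] [/= t'01 Sq'].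
  apply: eU; move: tt' qq'; rewrite -ball_normE /= => tt' /gballP[dlt qq' dr].
  have [[isd d2] [isd' d2']] := (DP _ Sq, DP _ Sq').
  have [/= h1 h2] := HP (t, q) t01 Sq; have [/= h3 h4] := HP (t', q') t'01 Sq'.
  have [|m zz' mle] := radial_lipschitz isd isd' qq' _ h1 h2 h3 h4.
    by move: dr; rewrite lt_min => /andP[]; lra.
  apply/gballP; exists m => //; apply: le_lt_trans mle _.
  have -> : `|radius t - radius t'| = `|t - t'| * (2 * eps).
    rewrite -[in RHS](ger0_norm (_ : 0 <= 2 * eps)); last by lra.
    by rewrite -normrM -normrN; congr (`|_|); rewrite /radius; ring.
  have : rho * (2 * eps + 3) <= e.
    by rewrite -ler_pdivlMr; [rewrite ge_min lexx orbT|lra].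
  suff : `|t - t'| * (2 * eps) <= rho * (2 * eps) by lra.
  by apply: ler_wpM2r; [lra|exact: ltW].
- move=> t q t01 Sq i iI; have [pz zq] := HP (t, q) t01 Sq.
  have [isd _] := DP q Sq.
  by have := closed_gball_convex epsg (Sp i iI) (Sq i iI) isd pz zq.
- move=> q Sq; have [_ d2] := DP q Sq.
  have [|_] := HP (0, q) _ Sq; first by rewrite /= in_itv /= lexx ler01.
  by rewrite /radius /= subr0 mul1r (min_idPr d2) subrr => /pl_path0.
- move=> q Sq; have [[pd _] _] := DP q Sq.
  have [|+ _] := HP (1, q) _ Sq; first by rewrite /= in_itv /= lexx ler01.
  by rewrite /radius /= subrr mul0r (min_idPl (pl_path_ge0 pd)) => /pl_path0.
Qed.

End TreeLikeBalls.

Theorem proposition4p7 (R : realType) (X : multigraph R)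
    (X_connected : connected [set: realization X])
    (n : nat) (xi : 'I_n -> realization X) (eps : R) :
  let C := girth (quotient_boundary X) in
  let A := fun i : 'I_n => closed_gball (xi i) eps in
  ((eps%:E < (4^-1)%:E * C)%E -> good_covering R A) /\
  ((eps%:E < (6^-1)%:E * C)%E -> nerve A = rips (nerve A)).
Proof.
move=> C A; split=> epsC.
  have [//|g epsg Xg] := girth_reduced_cycles_ge _ epsC.
  by move=> I I0 SI; apply: (contractible_common_part Xg epsg I0 SI).
have [//|g epsg Xg] := girth_reduced_cycles_ge _ epsC.
apply/val_inj/eqP; rewrite finset.eqEsubset; apply/andP; split.
  exact: rips_max.
apply/fintype.subsetP => I; rewrite !inE => /andP[I0 /forall_inP clique].
rewrite I0; apply/asboolP.
apply: (helly_closed_gball Xg epsg I0) => i j iI jI.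
have /forall_inP/(_ j jI) := clique i iI.
rewrite !inE => /andP[/andP[_ /asboolP[z zij]] _].
by exists z; split; apply: zij; rewrite /= !inE eqxx ?orbT.
Qed.
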